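(* There exists a covering system of the integers whose moduli are all odd and greater than $1$, in which exactly eight congruences have modulus $25$ and the congruences with moduli different from $25$ have pairwise distinct moduli.
   Context: A covering system is a finite collection of congruences $r_i\pmod{m_i}$ such that every integer satisfies at least one of them. *)

(* Defs.v *)
From Stdlib Require Import ZArith List.

Open Scope Z_scope.

Record congruence : Set := Congruence { residue : Z; modulus : Z }.

Definition satisfies (n : Z) (c : congruence) : Prop :=
  (modulus c | n - residue c).

Definition covering_system (S : list congruence) : Prop :=
  Forall (fun c => 0 < modulus c) S /\
  forall n : Z, Exists (satisfies n) S.

(* [n = r (mod m)] depends on [r] only modulo [m], so [1 (mod 25)] and
   [26 (mod 25)] are the same congruence; repetitions are tested on the reduced
   residues. *)
Definition pairwise_distinct (S : list congruence) : Prop :=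
  NoDup (map (fun c => (residue c mod modulus c, modulus c)) S).

(* Main.v *)
(** For a prime [p], an integer outside [p ^ D Z] has a level [a < D], its [p]-adic valuation,
    and one of [p - 1] classes, the residue modulo [p] of its quotient by [p ^ a]. The
    congruences modulo [p, p ^ 2, ..., p ^ D] can take the same class at every level, so together
    they act as one condition on [p - 1] classes. It then suffices to cover a finite product
    of sets of classes by conditions of distinct types, where a type records the primes
    that a condition involves; for [p = 5] one first fixes the residue modulo [25], since [5]
    and [25] are needed as moduli of their own. Such a covering with the primes [3, ..., 23] is
    checked by computation. The integers without a level at [p] are covered by congruences
    modulo [29 * p ^ a] with [0 < a <= D], whose residues modulo [29] run through all classes:
    this needs only that [D] is large. *)

Require Import Defs.
From Stdlib Require Import ZArith List.
From Stdlib Require Import Znumtheory Zpow_facts Lia Bool.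
Import ListNotations.

Open Scope Z_scope.

(** * Lists *)

Lemma NoDup_map_weaken {A B C : Type} (f : A -> B) (g : A -> C) (l : list A) :
  (forall x y, In x l -> In y l -> g x = g y -> f x = f y) ->
  NoDup (map f l) -> NoDup (map g l).
Proof.
  induction l as [|a l IH]; simpl; intros Hfg Hl; constructor; inversion Hl; subst.
  - intros Ha. apply in_map_iff in Ha as (y & Hy & Hin).
    apply H1, in_map_iff. exists y. split; auto.
  - apply IH; auto.
Qed.

(** Blocks that share an element have equal keys, so distinct keys make the blocks disjoint. The key
    will be the type of a condition, or the prime of a tail. *)
Lemma NoDup_flat_map {A B C : Type} (f : A -> list B) (key : A -> C) (l : list A) :
  (forall a, In a l -> NoDup (f a)) ->
  (forall a a' b, In a l -> In a' l -> In b (f a) -> In b (f a') -> key a = key a') ->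
  NoDup (map key l) -> NoDup (flat_map f l).
Proof.
  induction l as [|a l IH]; simpl; intros Hf Hkey Hl; [constructor|].
  inversion Hl; subst. apply NoDup_app; auto.
  - apply IH; auto. intros; eapply Hkey; eauto.
  - intros b Hb Hb'. apply in_flat_map in Hb' as (a' & Ha' & Hb').
    apply H1, in_map_iff. exists a'. split; auto. eapply Hkey; eauto.
Qed.

Fixpoint product {A : Type} (ls : list (list A)) : list (list A) :=
  match ls with
  | [] => [[]]
  | l :: ls => flat_map (fun x => map (cons x) (product ls)) l
  end.

Lemma in_product {A : Type} (ls : list (list A)) (v : list A) :
  In v (product ls) <-> Forall2 (@In A) v ls.
Proof.
  revert v. induction ls as [|l ls IH]; intros v; simpl.
  - split.
    + intros [<-|[]]. constructor.
    + intros H. inversion H. auto.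
  - rewrite in_flat_map. split.
    + intros (x & Hx & Hv). apply in_map_iff in Hv as (w & <- & Hw).
      constructor; auto. now apply IH.
    + intros H. inversion H; subst. exists x. split; auto.
      apply in_map, IH. auto.
Qed.

(** Applied with [f := fst]: vectors of pairs (exponent, residue) remain distinct after the residues
    are forgotten, so their moduli can be told apart. *)
Lemma NoDup_product {A B : Type} (f : A -> B) (ls : list (list A)) :
  Forall (fun l => NoDup (map f l)) ls -> NoDup (map (map f) (product ls)).
Proof.
  induction 1 as [|l ls Hl _ IH]; simpl; [repeat constructor; auto|].
  rewrite flat_map_concat_map, concat_map, map_map, <- flat_map_concat_map.
  apply NoDup_flat_map with (key := f); auto.
  - intros a _. rewrite map_map. simpl.
    rewrite <- (map_map (map f) (cons (f a))).
    apply NoDup_map_weaken with (f := fun w => w); [|now rewrite map_id].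
    congruence.
  - intros a a' b _ _ Hb Hb'.
    rewrite map_map in Hb, Hb'.
    apply in_map_iff in Hb as (w & <- & _).
    apply in_map_iff in Hb' as (w' & Hw' & _). simpl in Hw'. congruence.
Qed.

(** * Congruences modulo a factored number *)

(** An entry [(p, (e, r))] stands for the local condition [n = r (mod p ^ e)], and a list of entries
    for their conjunction. The exponent [0] is allowed and imposes nothing. *)
Definition exponent (x : Z * (nat * Z)) : Z := Z.of_nat (fst (snd x)).

Definition modulus_of (s : list (Z * (nat * Z))) : Z :=
  fold_right (fun x m => fst x ^ exponent x * m) 1 s.

Definition locally (n : Z) (x : Z * (nat * Z)) : Prop :=
  (fst x ^ exponent x | n - snd (snd x)).

Lemma prime_pos (p : Z) : prime p -> 0 < p.
Proof. intros H. pose proof (prime_ge_2 p H). lia. Qed.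

Lemma modulus_of_pos (s : list (Z * (nat * Z))) :
  Forall prime (map fst s) -> 0 < modulus_of s.
Proof.
  induction s as [|x s IH]; simpl; intros H; [lia|].
  inversion H; subst. apply Z.mul_pos_pos; auto.
  apply Z.pow_pos_nonneg; [now apply prime_pos | unfold exponent; lia].
Qed.

Lemma rel_prime_modulus_of (p : Z) (s : list (Z * (nat * Z))) :
  prime p -> Forall prime (map fst s) -> ~ In p (map fst s) ->
  rel_prime p (modulus_of s).
Proof.
  intros Hp. induction s as [|x s IH]; simpl; intros Hs Hin.
  - apply rel_prime_sym, rel_prime_1.
  - inversion Hs; subst. apply rel_prime_mult.
    + apply rel_prime_Zpower_r; [unfold exponent; lia|].
      apply rel_prime_sym, prime_rel_prime; auto.
      intros Hd. apply prime_div_prime in Hd; auto.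
    + apply IH; auto.
Qed.

Lemma chinese_remainder (s : list (Z * (nat * Z))) :
  Forall prime (map fst s) -> NoDup (map fst s) ->
  exists c, modulus c = modulus_of s /\
            forall n, Forall (locally n) s -> satisfies n c.
Proof.
  induction s as [|x s IH]; simpl; intros Hp Hd.
  - exists (Congruence 0 1). split; auto. intros n _. apply Z.divide_1_l.
  - inversion Hp; inversion Hd; subst.
    destruct IH as (c & Hm & Hc); auto.
    assert (Hrel : rel_prime (fst x ^ exponent x) (modulus_of s)).
    { apply rel_prime_sym, rel_prime_Zpower_r; [unfold exponent; lia|].
      apply rel_prime_sym, rel_prime_modulus_of; auto. }
    apply rel_prime_bezout in Hrel as [u v Huv].
    set (q := fst x ^ exponent x) in *. set (r := snd (snd x)).
    (* By the Bezout identity [u * q + v * modulus_of s = 1], this residue is [r] modulo [q] and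
       [residue c] modulo [modulus_of s]. *)
    exists (Congruence (r + u * q * (residue c - r)) (q * modulus_of s)).
    split; auto. intros n Hn. inversion Hn; subst.
    unfold satisfies; simpl.
    destruct H3 as [k Hk]. fold q r in Hk.
    destruct (Hc n) as [l Hl]; auto. rewrite Hm in Hl.
    exists (v * k + u * l).
    assert (E1 : n - (r + u * q * (residue c - r))
                 = (n - r) * (u * q + v * modulus_of s)
                   + u * q * (n - residue c) - u * q * (n - r)) by (rewrite Huv; ring).
    rewrite E1, Hl, Hk. ring.
Qed.

(** Unique factorization, one prime at a time: equal exponents of the first prime cancel, and
    unequal ones are excluded by [Hlt]. *)
Lemma modulus_of_inj (ps : list Z) (v w : list (nat * Z)) :
  Forall prime ps -> NoDup ps -> length v = length ps -> length w = length ps ->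
  modulus_of (combine ps v) = modulus_of (combine ps w) -> map fst v = map fst w.
Proof.
  revert v w. induction ps as [|p ps IH]; intros [|[e r] v] [|[f t] w];
    simpl; try discriminate; auto.
  intros Hp Hd Hv Hw Heq. inversion Hp; inversion Hd; subst.
  assert (Hfst : forall u : list (nat * Z), In p (map fst (combine ps u)) -> False).
  { intros u Hu. apply in_map_iff in Hu as ([a b] & <- & Hu).
    apply in_combine_l in Hu. auto. }
  assert (Hall : forall u : list (nat * Z), Forall prime (map fst (combine ps u))).
  { intros u. apply Forall_forall. intros a Ha.
    apply in_map_iff in Ha as ([a' b] & <- & Ha). apply in_combine_l in Ha.
    rewrite Forall_forall in H2. auto. }
  (* Cancelling [p ^ i] leaves [p] dividing a product of powers of other primes, to which it is
     coprime. *)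
  assert (Hlt : forall (u u' : list (nat * Z)) i j, (i < j)%nat ->
    p ^ Z.of_nat i * modulus_of (combine ps u) =
    p ^ Z.of_nat j * modulus_of (combine ps u') -> False).
  { intros u u' i j Hij E. pose proof (prime_ge_2 p H1).
    replace (Z.of_nat j) with (Z.of_nat i + (1 + Z.of_nat (j - i - 1))) in E by lia.
    rewrite !Z.pow_add_r, Z.pow_1_r, <- !Z.mul_assoc in E by lia.
    apply Z.mul_reg_l in E; [|apply Z.pow_nonzero; lia].
    assert (rel_prime p (modulus_of (combine ps u)))
      by (apply rel_prime_modulus_of; eauto).
    assert (p | 1) as Hdiv.
    { apply Gauss with (b := modulus_of (combine ps u)); auto.
      rewrite Z.mul_1_r, E. apply Z.divide_factor_l. }
    apply Z.divide_1_r in Hdiv. lia. }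
  unfold exponent in Heq; simpl in Heq.
  destruct (lt_eq_lt_dec e f) as [[Hef|Hef]|Hef].
  - exfalso; eauto.
  - subst f. apply Z.mul_reg_l in Heq;
      [|apply Z.pow_nonzero; pose proof (prime_ge_2 p H1); lia].
    f_equal. apply IH; auto.
  - exfalso; eauto.
Qed.

(** * Coordinates at a prime *)

(* [(p, b)] describes the coordinates of [n] at the prime [p]: a residue [c] of [n] modulo
   [p ^ b] and, when [n - c = p ^ b * p ^ a * y] with [y] prime to [p], the class [j] of [y]
   modulo [p]; the level [a] is ignored. *)
Definition base (pb : Z * nat) : Z := fst pb ^ Z.of_nat (snd pb).

(* Chosen so that the integers of level at least [levels pb] are covered by the moduli
   [29 * p ^ (k + 1)], [k < levels pb]. *)
Definition levels (pb : Z * nat) : nat := Z.to_nat (29 * base pb).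

(* [Real t r] is the condition [n = r (mod p ^ t)], meant for [t <= b]; [Fam c j] asks for the
   coordinates [(c, j)], which takes one residue class modulo [p ^ (b + a + 1)] for every
   level [a]. *)
Inductive loc : Set := Free | Real (t : nat) (r : Z) | Fam (c j : Z).

Definition options (pb : Z * nat) (l : loc) : list (nat * Z) :=
  match l with
  | Free => [(0%nat, 0)]
  | Real t r => [(t, r)]
  | Fam c j => map (fun a => ((snd pb + 1 + a)%nat, c + base pb * (fst pb ^ Z.of_nat a * j)))
                   (seq 0 (levels pb))
  end.

(** The test [t <=? snd pb] is needed for soundness: the first coordinate knows [n] only modulo
    [p ^ b]. *)
Definition hit (pb : Z * nat) (l : loc) (z : Z * Z) : bool :=
  match l with
  | Free => true
  | Real t r => (t <=? snd pb)%nat && ((fst z - r) mod fst pb ^ Z.of_nat t =? 0)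
  | Fam c j => (snd z =? j) && (fst z =? c)
  end.

Definition range (a : nat) (n : Z) : list Z := map Z.of_nat (seq a (Z.to_nat n)).

Definition coords (pb : Z * nat) : list (Z * Z) :=
  list_prod (range 0 (base pb)) (range 1 (fst pb - 1)).

Lemma in_range (a : nat) (n x : Z) : Z.of_nat a <= x < Z.of_nat a + n -> In x (range a n).
Proof.
  intros Hx. apply in_map_iff. exists (Z.to_nat x). split; [lia|].
  apply in_seq. lia.
Qed.

(** Induction on [k]: if [y = w * p ^ k], then either [p] divides [w] and one more power splits off,
    or the level is [k] and the class is [w mod p]. *)
Lemma level_class (p y : Z) (k : nat) :
  1 < p ->
  (p ^ Z.of_nat k | y) \/
  exists a j, (a < k)%nat /\ 1 <= j < p /\ (p ^ Z.of_nat (a + 1) | y - p ^ Z.of_nat a * j).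
Proof.
  intros Hp. induction k as [|k [[w Hw]|(a & j & Ha & Hj & Hd)]].
  - left. apply Z.divide_1_l.
  - assert (E : forall i : nat, p ^ Z.of_nat (i + 1) = p ^ Z.of_nat i * p).
    { intros i. rewrite Nat2Z.inj_add, Z.pow_add_r, Z.pow_1_r by lia. reflexivity. }
    pose proof (Z.mod_pos_bound w p ltac:(lia)) as Hb.
    pose proof (Z.div_mod w p ltac:(lia)) as Hdm.
    destruct (Z.eq_dec (w mod p) 0) as [Hz|Hz].
    + left. replace (S k) with (k + 1)%nat by lia. rewrite E.
      exists (w / p). rewrite Hw, Hdm at 1. rewrite Hz. ring.
    + right. exists k, (w mod p). repeat split; try lia. rewrite E.
      exists (w / p). rewrite Hw, Hdm at 1. ring.
  - right. exists a, j. repeat split; auto; lia.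
Qed.

(** Contains every integer without a level below [levels pb]; it is covered separately, with the
    help of the prime 29. *)
Definition tail (pb : Z * nat) (n : Z) : Prop :=
  exists c, 0 <= c < base pb /\ (fst pb ^ Z.of_nat (levels pb) | n - c).

Definition meets (p n : Z) (o : nat * Z) : Prop := (p ^ Z.of_nat (fst o) | n - snd o).

(** [level_class] is applied to the quotient of [n] by [B = p ^ b]. The remainder and the class are
    the coordinates; the level only decides which member of a [Fam] family contains [n]. *)
Lemma tail_or_coords (pb : Z * nat) (n : Z) :
  prime (fst pb) ->
  tail pb n \/
  exists z, In z (coords pb) /\
            forall l, hit pb l z = true -> exists o, In o (options pb l) /\ meets (fst pb) n o.
Proof.
  destruct pb as [p b]; simpl; intros Hp. pose proof (prime_ge_2 p Hp) as Hp2.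
  set (B := base (p, b)). assert (HB : B = p ^ Z.of_nat b) by reflexivity.
  assert (HB0 : 0 < B) by (rewrite HB; apply Z.pow_pos_nonneg; lia).
  pose proof (Z.mod_pos_bound n B HB0) as Hc.
  pose proof (Z.div_mod n B ltac:(lia)) as Hdm.
  destruct (level_class p (n / B) (levels (p, b)) ltac:(lia))
    as [[w Hw]|(a & j & Ha & Hj & w & Hw)].
  - left. exists (n mod B). split; auto.
    exists (B * w). rewrite Hdm at 1. rewrite Hw. cbn [fst]. ring.
  - right. exists (n mod B, j). split.
    { apply in_prod; apply in_range; cbn [fst]; fold B; lia. }
    intros [|t r|c i]; simpl.
    + intros _. eexists. split; [left; reflexivity|]. apply Z.divide_1_l.
    + intros H. apply andb_prop in H as [Ht Hr].
      apply Nat.leb_le in Ht. apply Z.eqb_eq in Hr.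
      eexists. split; [left; reflexivity|]. unfold meets; simpl.
      apply Z.mod_divide in Hr; [|apply Z.pow_nonzero; lia].
      (* [p ^ t] divides the first summand because [t <= b], and the second by [Hr]. *)
      replace (n - r) with (n / B * B + (n mod B - r)) by (rewrite Hdm at 3; ring).
      apply Z.divide_add_r; auto. apply Z.divide_mul_r.
      exists (p ^ Z.of_nat (b - t)). rewrite HB, <- Z.pow_add_r by lia. f_equal. lia.
    + intros H. apply andb_prop in H as [Hi Hci].
      apply Z.eqb_eq in Hi, Hci. subst i c.
      (* The level [a] of [n] selects the member of the family. *)
      eexists. split.
      { apply in_map_iff. exists a. split; [reflexivity|]. apply in_seq. lia. }
      unfold meets; simpl. fold B.
      replace (b + 1 + a)%nat with (b + (a + 1))%nat by lia.
      rewrite Nat2Z.inj_add, Z.pow_add_r, <- HB by lia.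
      exists w.
      replace (n - (n mod B + B * (p ^ Z.of_nat a * j)))
        with (B * (n / B - p ^ Z.of_nat a * j)) by (rewrite Hdm at 2; ring).
      rewrite Hw. ring.
Qed.

(** Writing [k = 29 * c + i] runs through all pairs of a residue [c] below [base pb] and a residue
    [i] modulo 29; there are [levels pb] of them. Each pair gets its own power [p ^ (k + 1)], which
    divides [p ^ levels pb], so a tail integer with data [c] and [i] satisfies the congruence
    numbered [k]. *)
Definition tail_cover (pb : Z * nat) : list (list (Z * (nat * Z))) :=
  map (fun k => [(29, (1%nat, Z.of_nat k mod 29)); (fst pb, (S k, Z.of_nat k / 29))])
      (seq 0 (levels pb)).

Lemma tail_covered (pb : Z * nat) (n : Z) :
  tail pb n -> exists s, In s (tail_cover pb) /\ Forall (locally n) s.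
Proof.
  intros (c & Hc & Hd).
  pose proof (Z.mod_pos_bound n 29 ltac:(lia)) as Hm.
  set (k := Z.to_nat (c * 29 + n mod 29)).
  assert (Hk : Z.of_nat k = c * 29 + n mod 29) by (unfold k; lia).
  (* Since [c < base pb], the number [k] is below [29 * base pb]. *)
  assert (Hlt : (k < levels pb)%nat) by (unfold levels; nia).
  exists [(29, (1%nat, Z.of_nat k mod 29)); (fst pb, (S k, Z.of_nat k / 29))].
  split.
  { apply in_map_iff. exists k. split; auto. apply in_seq. lia. }
  rewrite Hk, Z.div_add_l, (Z.div_small (n mod 29)), Z.add_0_r by lia.
  rewrite Z.add_comm, Z.mod_add, Z.mod_mod by lia.
  repeat constructor; unfold locally, exponent; simpl fst; simpl snd.
  - exists (n / 29). rewrite (Z.div_mod n 29) at 1 by lia. change (29 ^ Z.of_nat 1) with 29. ring.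
  - eapply Z.divide_trans; [|exact Hd].
    exists (fst pb ^ Z.of_nat (levels pb - S k)).
    rewrite <- Z.pow_add_r by lia. f_equal. lia.
Qed.

(** * Virtual congruences *)

(* A condition on [n] is a list of local ones, one for each place; a list that is too short
   stands for its extension by [Free]. *)
Definition head (e : list loc) : loc := hd Free e.

Fixpoint local_options (P : list (Z * nat)) (e : list loc) : list (list (nat * Z)) :=
  match P with
  | [] => []
  | pb :: P => options pb (head e) :: local_options P (tl e)
  end.

(** The levels at different [Fam] places vary independently, whence the product. *)
Definition expand (P : list (Z * nat)) (e : list loc) : list (list (Z * (nat * Z))) :=
  map (combine (map fst P)) (product (local_options P e)).

Fixpoint hits (P : list (Z * nat)) (e : list loc) (zs : list (Z * Z)) : Prop :=
  match P, zs with
  | pb :: P, z :: zs => hit pb (head e) z = true /\ hits P (tl e) zs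
  | _, _ => True
  end.

(* The exponents [b + 1, b + 2, ...] of a [Fam] condition are identified with [b + 1]. *)
Definition place_type (pb : Z * nat) (a : nat) : nat := Nat.min a (snd pb + 1).

Definition loc_type (pb : Z * nat) (l : loc) : nat :=
  match l with
  | Free => 0
  | Real t _ => place_type pb t
  | Fam _ _ => snd pb + 1
  end.

Fixpoint types (P : list (Z * nat)) (e : list loc) : list nat :=
  match P with
  | [] => []
  | pb :: P => loc_type pb (head e) :: types P (tl e)
  end.

(** Recovers the type of a condition from exponents alone; with [modulus_of_inj], a modulus
    therefore determines the type of the condition it comes from. *)
Fixpoint exponent_types (P : list (Z * nat)) (v : list nat) : list nat :=
  match P, v with
  | pb :: P, a :: v => place_type pb a :: exponent_types P v
  | _, _ => []
  end.

Lemma options_type (pb : Z * nat) (l : loc) (o : nat * Z) :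
  In o (options pb l) -> place_type pb (fst o) = loc_type pb l.
Proof.
  destruct l as [|t r|c j]; simpl.
  - intros [<-|[]]. reflexivity.
  - intros [<-|[]]. reflexivity.
  - intros H. apply in_map_iff in H as (a & <- & _). unfold place_type; simpl. lia.
Qed.

Lemma NoDup_options (pb : Z * nat) (l : loc) : NoDup (map fst (options pb l)).
Proof.
  destruct l as [|t r|c j]; simpl; [repeat constructor; auto..|].
  rewrite map_map. apply NoDup_map_weaken with (f := fun a => a).
  - simpl. lia.
  - rewrite map_id. apply seq_NoDup.
Qed.

Lemma product_types (P : list (Z * nat)) (e : list loc) (v : list (nat * Z)) :
  In v (product (local_options P e)) ->
  length v = length P /\ exponent_types P (map fst v) = types P e.
Proof.
  rewrite in_product. revert e v.
  induction P as [|pb P IH]; simpl; intros e v H; inversion H; subst; simpl; auto.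
  destruct (IH _ _ H4) as [-> ->]. split; auto. f_equal. now apply options_type.
Qed.

(** Within one condition the exponent vectors differ. Between two conditions, a common modulus would
    give equal exponents and hence equal types. So distinctness of a huge family of moduli reduces
    to a finite check on types. *)
Lemma NoDup_expand (P : list (Z * nat)) (es : list (list loc)) :
  Forall prime (map fst P) -> NoDup (map fst P) -> NoDup (map (types P) es) ->
  NoDup (map modulus_of (flat_map (expand P) es)).
Proof.
  intros Hp Hd Hes.
  rewrite flat_map_concat_map, concat_map, map_map, <- flat_map_concat_map.
  apply NoDup_flat_map with (key := types P); auto.
  - intros e _. unfold expand. rewrite map_map.
    apply NoDup_map_weaken with (f := map fst).
    + intros v w Hv Hw. apply product_types in Hv, Hw. apply modulus_of_inj; auto;
        rewrite length_map; tauto.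
    + apply NoDup_product. generalize e. clear.
      induction P as [|pb P IH]; simpl; constructor; auto using NoDup_options.
  - intros e e' m _ _ Hm Hm'. unfold expand in Hm, Hm'.
    rewrite map_map in Hm, Hm'.
    apply in_map_iff in Hm as (v & <- & Hv).
    apply in_map_iff in Hm' as (w & Hw' & Hw).
    apply product_types in Hv as [Hv <-], Hw as [Hw <-]. f_equal. symmetry.
    apply modulus_of_inj in Hw'; auto; rewrite length_map; auto.
Qed.

Lemma in_expand (P : list (Z * nat)) (es : list (list loc)) (s : list (Z * (nat * Z))) :
  In s (flat_map (expand P) es) -> map fst s = map fst P.
Proof.
  intros H. apply in_flat_map in H as (e & _ & H).
  apply in_map_iff in H as (v & <- & H). apply product_types in H as [H _].
  revert v H. induction P as [|pb P IH]; intros [|o v]; simpl; try discriminate; auto.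
  intros H. f_equal. apply IH. auto.
Qed.

(** The coordinates [zs] are chosen before the condition [e], so coverage becomes a question about
    finitely many coordinate vectors. *)
Lemma tails_or_coords (P : list (Z * nat)) (n : Z) :
  Forall prime (map fst P) ->
  (exists pb, In pb P /\ tail pb n) \/
  exists zs, Forall2 (fun z pb => In z (coords pb)) zs P /\
             forall e, hits P e zs -> exists s, In s (expand P e) /\ Forall (locally n) s.
Proof.
  induction P as [|pb P IH]; simpl; intros Hp.
  - right. exists []. split; [constructor|]. intros e _. exists []. simpl. auto.
  - inversion Hp; subst.
    destruct (tail_or_coords pb n H1) as [Ht|(z & Hz & Hl)]; [left; eauto|].
    destruct (IH H2) as [(pb' & Hin & Ht)|(zs & Hzs & He)]; [left; eauto|].
    right. exists (z :: zs). split; [constructor; auto|].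
    intros e [Hh Hhs]. destruct (Hl _ Hh) as (o & Ho & Hn).
    destruct (He _ Hhs) as (s & Hs & Hns).
    exists ((fst pb, o) :: s). split; [|constructor; auto].
    apply in_map_iff in Hs as (v & <- & Hv).
    apply in_map_iff. exists (o :: v). split; auto.
    simpl. apply in_flat_map. exists o. split; auto. now apply in_map.
Qed.

Definition is_nil (e : list loc) : bool := match e with [] => true | _ => false end.

(** An exhausted condition is free at all remaining places, so the search can stop there. This early
    exit makes the computation feasible: [places] has more than 900 million coordinate vectors. *)
Fixpoint covers (P : list (Z * nat)) (es : list (list loc)) : bool :=
  if existsb is_nil es then true else
  match P with
  | [] => false
  | pb :: P =>
      forallb (fun z => covers P (map (@tl loc) (filter (fun e => hit pb (head e) z) es)))
              (coords pb)
  end.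

Lemma hits_nil (P : list (Z * nat)) (zs : list (Z * Z)) : hits P [] zs.
Proof. revert zs. induction P as [|pb P IH]; intros [|z zs]; simpl; auto. Qed.

Lemma covers_correct (P : list (Z * nat)) (es : list (list loc)) (zs : list (Z * Z)) :
  covers P es = true -> Forall2 (fun z pb => In z (coords pb)) zs P ->
  exists e, In e es /\ hits P e zs.
Proof.
  intros H Hzs. revert es H.
  induction Hzs as [|z pb zs P Hz _ IH]; intros es H; cbn [covers] in H;
    destruct (existsb is_nil es) eqn:E.
  1, 3: apply existsb_exists in E as ([|l e] & He & ?); [|discriminate];
    exists []; split; [assumption | apply hits_nil].
  - discriminate.
  - rewrite forallb_forall in H. destruct (IH _ (H z Hz)) as (e' & He' & Hh).
    apply in_map_iff in He' as (e & <- & He). apply filter_In in He as [He Hl].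
    exists e. split; [assumption | split; assumption].
Qed.

(** * The covering *)

Definition places : list (Z * nat) :=
  [(3, 0%nat); (5, 2%nat); (7, 0%nat); (11, 0%nat); (13, 0%nat); (17, 0%nat); (19, 0%nat);
   (23, 0%nat)].

(** At a place with [b = 0] the residue coordinate is always [0]. Classes start at 1, which leaves
    [0] to encode [Free]. *)
Definition fam (j : Z) : loc := if j =? 0 then Free else Fam 0 j.

(** The list [js] gives the classes at 7, 11, 13, 17, 19, 23 in this order; free places at the end
    are omitted, for the early exit in [covers]. *)
Definition row (j3 : Z) (l5 : loc) (js : list Z) : list loc := fam j3 :: l5 :: map fam js.

(** These cover the class 0 modulo 5 and, in the class 1 modulo 5, all but 6 and 11. After the first
    four rows of [table] there remain only class 2 at the prime 3 with residue 6 modulo 25 or 4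
    modulo 5. There a factor 3 costs nothing, so most later rows come in pairs, with and without
    it. *)
Definition twenty_fives : list Z := [0; 1; 5; 10; 15; 16; 20; 21].

(* Found by simulated annealing, adding one prime after another. Up to the prime [17] the
   quantity maximised is the sum, over all types, of the largest proportion of the uncovered
   cells that a condition of the type can contain. *)
Definition table : list (list loc) := [
    row 1 Free []; row 0 (Real 1 2) []; row 2 (Real 1 3) []; row 2 (Real 2 11) [];
    row 0 (Fam 6 2) []; row 2 (Fam 6 4) []; row 0 Free [5]; row 2 Free [3];
    row 0 (Real 1 4) [2]; row 2 (Real 1 4) [4]; row 0 (Real 2 6) [4]; row 2 (Real 2 6) [2];
    row 0 (Fam 6 1) [6]; row 2 (Fam 6 1) [1]; row 0 Free [0;2]; row 2 Free [0;9];
    row 0 (Real 1 4) [0;10]; row 2 (Real 1 4) [0;5]; row 0 (Real 2 4) [0;8];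
    row 2 (Real 2 9) [0;8]; row 0 (Fam 6 3) [0;8]; row 2 (Fam 6 3) [0;5]; row 0 Free [1;1];
    row 2 Free [1;4]; row 0 (Real 1 4) [1;3]; row 2 (Real 1 4) [1;7]; row 0 (Real 2 14) [1;8];
    row 2 (Real 2 24) [1;8]; row 0 (Fam 6 3) [1;7]; row 2 (Fam 6 3) [1;10]; row 0 Free [0;0;7];
    row 2 Free [0;0;8]; row 0 (Real 1 4) [0;0;10]; row 2 (Real 1 4) [0;0;6];
    row 0 (Real 2 19) [0;0;1]; row 2 (Real 2 14) [0;0;1]; row 0 (Fam 6 3) [0;0;2];
    row 2 (Fam 6 3) [0;0;9]; row 0 Free [6;0;11]; row 2 Free [6;0;4]; row 0 (Real 1 4) [6;0;2];
    row 2 (Real 1 4) [6;0;9]; row 0 (Real 2 4) [6;0;1]; row 2 (Real 2 9) [6;0;1];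
    row 0 (Fam 6 3) [6;0;10]; row 2 (Fam 6 3) [6;0;6]; row 0 Free [0;3;3]; row 2 Free [0;3;5];
    row 0 (Real 1 4) [0;7;3]; row 2 (Real 1 4) [0;4;5]; row 0 (Real 2 19) [0;8;5];
    row 2 (Real 2 19) [0;8;3]; row 0 (Fam 6 3) [0;6;1]; row 2 (Fam 6 3) [0;3;1];
    row 0 Free [6;4;3]; row 2 Free [6;7;5]; row 0 (Real 1 4) [6;1;5]; row 2 (Real 1 4) [6;1;3];
    row 0 (Real 2 19) [1;8;2]; row 2 (Real 2 19) [1;8;4]; row 0 (Fam 19 1) [1;8;9];
    row 2 (Fam 6 3) [1;3;11]; row 0 Free [0;0;0;8]; row 2 Free [0;0;0;11];
    row 0 (Real 1 4) [0;0;0;7]; row 2 (Real 1 4) [0;0;0;10]; row 0 (Real 2 6) [0;0;0;7];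
    row 2 (Real 2 6) [0;0;0;9]; row 0 (Fam 6 3) [0;0;0;15]; row 2 (Fam 6 3) [0;0;0;13];
    row 0 Free [1;0;0;12]; row 2 Free [1;0;0;4]; row 0 (Real 1 4) [1;0;0;13];
    row 2 (Real 1 4) [1;0;0;1]; row 0 (Real 2 24) [6;0;0;15]; row 2 (Real 2 24) [6;0;0;2];
    row 0 (Fam 6 3) [6;0;0;1]; row 2 (Fam 6 3) [6;0;0;10]; row 0 Free [0;6;0;6];
    row 2 Free [0;6;0;16]; row 0 (Real 1 4) [0;6;0;9]; row 2 (Real 1 4) [0;6;0;3];
    row 0 (Real 2 19) [0;8;0;14]; row 2 (Real 2 19) [0;8;0;16]; row 0 (Fam 6 3) [0;6;0;3];
    row 2 (Fam 6 3) [0;10;0;16]; row 0 Free [1;6;0;2]; row 2 Free [1;6;0;14];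
    row 0 (Real 1 4) [6;6;0;2]; row 2 (Real 1 4) [1;6;0;15]; row 0 (Real 2 19) [1;8;0;6];
    row 2 (Real 2 19) [1;8;0;9]; row 0 (Fam 6 3) [1;3;0;1]; row 2 (Fam 6 3) [1;6;0;10];
    row 0 Free [0;0;1;6]; row 2 Free [0;0;5;12]; row 0 (Real 1 4) [0;0;1;3];
    row 2 (Real 1 4) [0;0;3;4]; row 0 (Real 2 24) [0;0;1;14]; row 2 (Real 2 24) [0;0;1;13];
    row 0 (Fam 6 3) [0;0;12;14]; row 2 (Fam 6 3) [0;0;12;2]; row 0 Free [6;0;1;12];
    row 2 Free [6;0;3;12]; row 0 (Real 1 4) [6;0;1;16]; row 2 (Real 1 4) [6;0;1;4];
    row 0 (Real 2 24) [6;0;1;1]; row 2 (Real 2 24) [6;0;1;9]; row 0 (Fam 6 3) [6;0;1;14];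
    row 2 (Fam 6 3) [6;0;12;4]; row 0 Free [0;6;5;4]; row 2 Free [0;6;5;14];
    row 0 (Real 1 4) [0;6;3;13]; row 2 (Real 1 4) [0;6;5;13]; row 0 (Real 2 24) [0;8;5;16];
    row 2 (Real 2 24) [0;8;5;6]; row 0 (Fam 19 3) [0;8;9;2]; row 2 (Fam 4 3) [0;7;12;13];
    row 0 Free [6;6;3;14]; row 2 Free [6;7;12;6]; row 0 (Real 1 4) [6;6;5;1];
    row 2 (Real 1 4) [6;6;3;1]; row 0 (Real 2 24) [6;8;3;16]; row 2 (Real 2 19) [1;8;11;3];
    row 0 (Fam 6 3) [6;1;5;16]; row 2 (Fam 6 3) [6;1;5;14]; row 0 Free [0;0;0;0;6];
    row 2 Free [0;0;0;0;12]; row 0 (Real 1 4) [0;0;0;0;9]; row 2 (Real 1 4) [0;0;0;0;15];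
    row 0 (Real 2 6) [0;0;0;0;8]; row 2 (Real 2 6) [0;0;0;0;10]; row 0 (Fam 6 3) [0;0;0;0;9];
    row 2 (Fam 6 3) [0;0;0;0;5]; row 0 Free [6;0;0;0;18]; row 2 Free [6;0;0;0;4];
    row 0 (Real 1 4) [6;0;0;0;5]; row 2 (Real 1 4) [6;0;0;0;10]; row 0 (Real 2 14) [6;0;0;0;3];
    row 2 (Real 2 4) [6;0;0;0;3]; row 0 (Fam 6 3) [6;0;0;0;15]; row 2 (Fam 6 3) [6;0;0;0;3];
    row 0 Free [0;8;0;0;13]; row 2 Free [0;6;0;0;16]; row 0 (Real 1 4) [0;8;0;0;8];
    row 2 (Real 1 4) [0;8;0;0;16]; row 0 (Real 2 19) [0;8;0;0;5]; row 2 (Real 2 19) [0;8;0;0;4];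
    row 0 (Fam 6 3) [0;3;0;0;14]; row 2 (Fam 6 3) [0;3;0;0;7]; row 0 Free [6;8;0;0;17];
    row 2 Free [6;4;0;0;16]; row 0 (Real 1 4) [6;8;0;0;11]; row 2 (Real 1 4) [6;8;0;0;14];
    row 0 (Real 2 24) [6;8;0;0;3]; row 2 (Real 2 19) [1;8;0;0;18]; row 0 (Fam 6 3) [1;3;0;0;15];
    row 2 (Fam 6 3) [1;3;0;0;18]; row 0 Free [0;0;12;0;2]; row 2 Free [0;0;12;0;11];
    row 0 (Real 1 4) [0;0;12;0;13]; row 2 (Real 1 4) [0;0;12;0;14];
    row 0 (Real 2 19) [0;0;12;0;3]; row 2 (Real 2 9) [0;0;12;0;3]; row 0 (Fam 6 3) [0;0;3;0;11];
    row 2 (Fam 6 3) [0;0;12;0;13]; row 0 Free [6;0;12;0;1]; row 2 Free [6;0;12;0;7];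
    row 0 (Real 1 4) [6;0;12;0;17]; row 2 (Real 1 4) [6;0;12;0;8];
    row 0 (Real 2 6) [6;0;3;0;13]; row 2 (Real 2 24) [6;0;12;0;3]; row 0 (Fam 6 3) [6;0;3;0;16];
    row 2 (Fam 6 3) [6;0;5;0;11]; row 0 Free [0;1;12;0;16]; row 2 Free [0;3;12;0;16];
    row 0 (Real 1 4) [0;8;5;0;7]; row 2 (Real 1 4) [0;8;3;0;1]; row 0 (Real 2 14) [0;8;5;0;1];
    row 2 (Real 2 19) [0;8;11;0;11]; row 0 (Fam 6 3) [0;4;5;0;13]; row 2 (Fam 6 3) [0;3;4;0;13];
    row 0 Free [6;8;5;0;2]; row 2 Free [6;7;12;0;16]; row 0 (Real 1 4) [6;8;3;0;7];
    row 2 (Real 1 4) [6;8;3;0;2]; row 0 (Real 2 19) [1;8;11;0;14];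
    row 2 (Real 2 24) [6;8;5;0;1]; row 0 (Fam 6 3) [1;3;6;0;16]; row 2 (Fam 6 3) [1;3;10;0;11];
    row 0 Free [0;0;0;5;17]; row 2 Free [0;0;0;5;7]; row 0 (Real 1 4) [0;0;0;5;1];
    row 2 (Real 1 4) [0;0;0;5;2]; row 0 (Real 2 19) [0;0;0;15;3]; row 2 (Real 2 6) [0;0;0;2;1];
    row 0 (Fam 6 3) [0;0;0;5;1]; row 2 (Fam 6 3) [0;0;0;5;2]; row 0 Free [1;0;0;5;4];
    row 2 Free [1;0;0;5;3]; row 0 (Real 1 4) [1;0;0;5;10]; row 2 (Real 1 4) [6;0;0;5;3];
    row 0 (Real 2 6) [6;0;0;3;17]; row 2 (Real 2 6) [6;0;0;3;14]; row 0 (Fam 6 3) [6;0;0;2;2];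
    row 2 (Fam 6 3) [6;0;0;2;7]; row 0 Free [0;6;0;5;13]; row 2 Free [0;6;0;5;14];
    row 0 (Real 1 4) [0;6;0;5;11]; row 2 (Real 1 4) [0;6;0;5;8]; row 0 (Real 2 19) [0;8;0;15;1];
    row 2 (Real 2 19) [0;8;0;15;17]; row 0 (Fam 6 3) [0;6;0;1;7]; row 2 (Fam 6 3) [0;6;0;1;14];
    row 0 Free [6;6;0;15;13]; row 2 Free [1;6;0;5;18]; row 0 (Real 1 4) [6;6;0;15;2];
    row 2 (Real 1 4) [1;6;0;5;5]; row 0 (Real 2 19) [1;8;0;15;7];
    row 2 (Real 2 19) [1;8;0;15;10]; row 0 (Fam 6 3) [1;6;0;1;3]; row 2 (Fam 6 3) [1;6;0;5;15];
    row 0 Free [0;0;1;5;13]; row 2 Free [0;0;1;5;14]; row 0 (Real 1 4) [0;0;5;15;7];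
    row 2 (Real 1 4) [0;0;3;15;7]; row 0 (Real 2 6) [0;0;12;16;17];
    row 2 (Real 2 6) [0;0;3;4;7]; row 0 (Fam 6 3) [0;0;12;12;17]; row 2 (Fam 6 3) [0;0;1;3;2];
    row 0 Free [6;0;1;5;11]; row 2 Free [6;0;5;15;1]; row 0 (Real 1 4) [6;0;1;5;8];
    row 2 (Real 1 4) [6;0;3;15;14]; row 0 (Real 2 24) [6;0;1;5;16];
    row 2 (Real 2 6) [6;0;12;12;14]; row 0 (Fam 6 3) [6;0;1;2;14]; row 2 (Fam 6 3) [6;0;1;4;7];
    row 0 Free [0;6;5;15;8]; row 2 Free [0;6;3;15;11]; row 0 (Real 1 4) [0;6;3;15;8];
    row 2 (Real 1 4) [0;6;5;15;11]; row 0 (Real 2 19) [0;8;11;2;17];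
    row 2 (Real 2 19) [0;8;12;2;17]; row 0 (Fam 6 3) [0;3;12;6;17]; row 2 (Fam 6 3) [0;1;5;4;1];
    row 0 Free [6;6;5;15;17]; row 2 Free [6;6;5;15;14]; row 0 (Real 1 4) [6;6;3;15;1];
    row 2 (Real 1 4) [6;6;3;15;17]; row 0 (Real 2 19) [1;8;11;2;10];
    row 2 (Real 2 19) [1;8;12;3;1]; row 0 (Fam 6 3) [6;7;1;4;13]; row 2 (Fam 6 3) [1;3;4;14;16];
    row 0 Free [0;0;0;0;0;1]; row 2 Free [0;0;0;0;0;15]; row 0 (Real 1 1) [0;0;0;0;0;7];
    row 2 (Real 1 1) [0;0;0;0;0;21]; row 0 (Real 2 6) [0;0;0;0;0;17];
    row 2 (Real 2 6) [0;0;0;0;0;9]; row 0 (Fam 6 3) [0;0;0;0;0;6];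
    row 2 (Fam 6 3) [0;0;0;0;0;13]; row 0 Free [6;0;0;0;0;18]; row 2 Free [1;0;0;0;0;18];
    row 0 (Real 1 1) [6;0;0;0;0;11]; row 2 (Real 1 1) [6;0;0;0;0;4];
    row 0 (Real 2 6) [1;0;0;0;0;4]; row 2 (Real 2 19) [1;0;0;0;0;7];
    row 0 (Fam 6 3) [6;0;0;0;0;14]; row 2 (Fam 6 3) [6;0;0;0;0;19]; row 0 Free [0;8;0;0;0;11];
    row 2 Free [0;3;0;0;0;22]; row 0 (Real 1 4) [0;8;0;0;0;3]; row 2 (Real 1 1) [0;3;0;0;0;5];
    row 0 (Real 2 6) [0;3;0;0;0;19]; row 2 (Real 2 19) [0;8;0;0;0;14];
    row 0 (Fam 6 3) [0;3;0;0;0;14]; row 2 (Fam 6 3) [0;3;0;0;0;2]; row 0 Free [1;8;0;0;0;22];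
    row 2 Free [1;3;0;0;0;10]; row 0 (Real 1 4) [1;8;0;0;0;20]; row 2 (Real 1 4) [1;8;0;0;0;2];
    row 0 (Real 2 6) [1;3;0;0;0;20]; row 2 (Real 2 19) [1;8;0;0;0;10];
    row 0 (Fam 6 3) [1;3;0;0;0;16]; row 2 (Fam 6 3) [1;3;0;0;0;12]; row 0 Free [0;0;3;0;0;20];
    row 2 Free [0;0;5;0;0;10]; row 0 (Real 1 1) [0;0;3;0;0;10]; row 2 (Real 1 1) [0;0;3;0;0;22];
    row 0 (Real 2 6) [0;0;5;0;0;20]; row 2 (Real 2 6) [0;0;3;0;0;8];
    row 0 (Fam 6 3) [0;0;5;0;0;22]; row 2 (Fam 6 3) [0;0;1;0;0;8]; row 0 Free [6;0;5;0;0;2];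
    row 2 Free [6;0;3;0;0;2]; row 0 (Real 1 1) [6;0;1;0;0;5]; row 2 (Real 1 1) [6;0;1;0;0;20];
    row 0 (Real 2 6) [6;0;1;0;0;22]; row 2 (Real 2 6) [6;0;5;0;0;5];
    row 0 (Fam 6 3) [6;0;5;0;0;8]; row 2 (Fam 6 3) [6;0;3;0;0;5]; row 0 Free [0;8;9;0;0;21];
    row 2 Free [0;8;9;0;0;9]; row 0 (Real 1 4) [0;8;12;0;0;17]; row 2 (Real 1 4) [0;8;9;0;0;17];
    row 0 (Real 2 19) [0;8;9;0;0;4]; row 2 (Real 2 19) [0;8;9;0;0;19];
    row 0 (Fam 6 3) [0;3;12;0;0;11]; row 2 (Fam 6 3) [0;3;10;0;0;11]; row 0 Free [1;8;9;0;0;12];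
    row 2 Free [1;8;9;0;0;5]; row 0 (Real 1 4) [1;8;9;0;0;13]; row 2 (Real 1 4) [1;8;12;0;0;4];
    row 0 (Real 2 19) [1;8;11;0;0;5]; row 2 (Real 2 19) [1;8;9;0;0;8];
    row 0 (Fam 6 3) [1;3;6;0;0;11]; row 2 (Fam 6 3) [1;3;4;0;0;11]; row 0 Free [0;0;0;2;0;10];
    row 2 Free [0;0;0;5;0;16]; row 0 (Real 1 1) [0;0;0;16;0;16];
    row 2 (Real 1 4) [0;0;0;15;0;6]; row 0 (Real 2 19) [0;0;0;15;0;16];
    row 2 (Real 2 19) [0;0;0;2;0;21]; row 0 (Fam 6 3) [0;0;0;4;0;16];
    row 2 (Fam 6 3) [0;0;0;2;0;16]; row 0 Free [1;0;0;2;0;6]; row 2 Free [1;0;0;2;0;16];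
    row 0 (Real 1 1) [1;0;0;1;0;12]; row 2 (Real 1 1) [6;0;0;3;0;16];
    row 0 (Real 2 6) [1;0;0;1;0;20]; row 2 (Real 2 6) [6;0;0;6;0;16];
    row 0 (Fam 6 3) [6;0;0;14;0;16]; row 2 (Fam 6 3) [1;0;0;1;0;5]; row 0 Free [0;8;0;3;0;16];
    row 2 Free [0;8;0;3;0;6]; row 0 (Real 1 1) [0;6;0;1;0;22]; row 2 (Real 1 1) [0;6;0;1;0;10];
    row 0 (Real 2 6) [0;6;0;1;0;14]; row 2 (Real 2 6) [0;6;0;1;0;16];
    row 0 (Fam 6 3) [0;6;0;1;0;19]; row 2 (Fam 6 3) [0;6;0;1;0;11]; row 0 Free [1;8;0;2;0;12];
    row 2 Free [1;6;0;1;0;2]; row 0 (Real 1 4) [1;8;0;2;0;19]; row 2 (Real 1 4) [1;8;0;2;0;13];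
    row 0 (Real 2 19) [1;8;0;2;0;8]; row 2 (Real 2 19) [1;8;0;2;0;9];
    row 0 (Fam 6 3) [1;6;0;1;0;8]; row 2 (Fam 6 3) [1;6;0;1;0;3]; row 0 Free [0;0;12;3;0;9];
    row 2 Free [0;0;12;6;0;5]; row 0 (Real 1 4) [0;0;11;15;0;19];
    row 2 (Real 1 1) [0;0;1;3;0;10]; row 0 (Real 2 19) [0;0;11;2;0;4];
    row 2 (Real 2 19) [0;0;12;3;0;19]; row 0 (Fam 6 3) [0;0;1;16;0;2];
    row 2 (Fam 6 3) [0;0;1;3;0;2]; row 0 Free [6;0;12;6;0;2]; row 2 Free [6;0;1;2;0;2];
    row 0 (Real 1 1) [6;0;1;4;0;10]; row 0 (Real 2 6) [6;0;12;16;0;2];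
    row 2 (Real 2 19) [1;0;12;3;0;21]; row 0 (Fam 6 3) [6;0;1;16;0;10];
    row 2 (Fam 6 3) [6;0;1;4;0;2]; row 0 Free [0;8;12;3;0;12]; row 2 Free [0;8;11;15;0;13];
    row 0 (Real 1 4) [0;8;12;3;0;13]; row 2 (Real 1 4) [0;8;12;2;0;5];
    row 0 (Real 2 19) [0;8;12;3;0;8]; row 0 Free [1;8;12;3;0;5]; row 2 Free [6;6;5;15;0;17];
    row 0 (Real 1 4) [1;8;9;5;0;6]; row 2 (Real 1 4) [1;8;11;2;0;17]; row 0 Free [0;0;0;0;13;3];
    row 2 Free [0;0;0;0;3;3]; row 0 (Real 1 1) [0;0;0;0;17;3]; row 2 (Real 1 1) [0;0;0;0;1;12];
    row 0 (Real 2 6) [0;0;0;0;16;3]; row 2 (Real 2 6) [0;0;0;0;2;3];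
    row 0 (Fam 6 3) [0;0;0;0;1;3]; row 2 (Fam 6 3) [0;0;0;0;17;12]; row 0 Free [6;0;0;0;2;12];
    row 2 Free [6;0;0;0;7;12]; row 0 (Real 1 1) [1;0;0;0;11;8];
    row 2 (Real 1 1) [6;0;0;0;14;12]; row 0 (Real 2 6) [6;0;0;0;13;12];
    row 2 (Real 2 6) [6;0;0;0;14;3]; row 0 (Fam 6 3) [6;0;0;0;16;12];
    row 2 (Fam 6 3) [6;0;0;0;7;3]; row 0 Free [0;3;0;0;1;8]; row 2 Free [0;6;0;0;3;12];
    row 2 (Real 1 1) [0;3;0;0;4;3]; row 0 (Real 2 6) [0;6;0;0;11;10];
    row 0 (Fam 6 3) [0;3;0;0;2;8]; row 2 (Fam 6 3) [0;3;0;0;11;3]; row 0 Free [1;3;0;0;4;8];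
    row 2 Free [1;3;0;0;3;8]; row 0 (Real 1 4) [6;6;0;0;3;21]; row 2 (Real 1 1) [1;3;0;0;17;8];
    row 2 (Real 2 9) [6;6;0;0;3;5]; row 0 (Fam 6 3) [1;6;0;0;11;2];
    row 2 (Fam 6 3) [1;3;0;0;16;8]; row 2 Free [0;0;10;0;13;8];
    row 2 (Real 1 1) [0;0;12;0;14;8]; row 0 (Real 2 6) [0;0;1;0;11;12];
    row 0 (Fam 6 3) [0;0;12;0;14;22]; row 0 Free [6;0;1;0;11;3]; row 2 Free [6;0;12;0;14;20];
    row 0 (Real 1 1) [6;0;12;0;14;5]; row 2 (Real 1 1) [6;0;12;0;16;5];
    row 2 (Real 2 9) [6;0;5;0;3;7]; row 0 (Fam 6 3) [6;0;12;0;14;10];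
    row 2 (Fam 6 3) [1;0;6;0;13;8]; row 0 (Real 1 1) [0;10;12;0;16;10];
    row 2 (Real 1 1) [0;10;12;0;16;2]; row 2 (Real 2 9) [0;6;3;0;3;11];
    row 0 (Fam 6 3) [0;10;12;0;16;8]; row 2 (Fam 6 3) [0;10;12;0;16;22];
    row 0 Free [6;10;12;0;16;20]; row 0 (Real 2 9) [6;6;5;0;3;20];
    row 2 (Real 2 9) [6;6;3;0;3;7]; row 0 Free [0;0;0;15;3;9]; row 2 Free [0;0;0;5;11;19];
    row 0 (Real 1 1) [0;0;0;5;11;5]; row 2 (Real 1 1) [0;0;0;5;14;2];
    row 0 (Real 2 19) [0;0;0;15;2;21]; row 2 (Real 2 6) [0;0;0;6;17;10];
    row 0 (Fam 6 3) [0;0;0;6;17;20]; row 0 Free [1;0;0;5;11;22]; row 2 Free [1;0;0;5;11;20];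
    row 0 (Real 1 1) [6;0;0;6;17;8]; row 2 (Real 1 4) [6;0;0;15;3;14];
    row 0 (Real 2 9) [6;0;0;15;3;8]; row 2 (Real 2 6) [6;0;0;5;16;10];
    row 0 (Fam 6 3) [1;0;0;5;11;3]; row 2 (Fam 6 3) [6;0;0;5;16;2]; row 0 Free [0;6;0;15;3;13];
    row 2 Free [0;6;0;5;11;11]; row 0 (Real 2 9) [0;6;0;15;3;22];
    row 0 (Fam 6 3) [0;6;0;5;11;14]; row 0 Free [1;8;0;15;2;8]; row 2 Free [6;6;0;15;3;19];
    row 0 (Real 1 4) [6;6;0;15;3;4]; row 0 (Real 2 9) [6;6;0;15;3;16];
    row 2 (Real 2 6) [6;10;0;12;16;16]; row 2 (Fam 6 3) [1;6;0;5;11;12];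
    row 0 Free [0;0;11;15;2;17]; row 2 (Fam 6 3) [0;0;12;6;17;22];
    row 0 (Real 1 4) [1;0;11;15;2;12]; row 2 (Real 1 4) [6;0;3;15;3;10];
    row 0 (Real 2 9) [0;6;5;15;3;11]; row 0 (Real 1 4) [6;6;3;15;3;17];
    row 2 (Real 1 4) [1;8;11;15;2;4]; row 0 (Real 2 19) [1;8;11;15;2;9]
  ].

(** All eight conditions have the same type, that of the modulus 25. *)
Definition repeated (r : Z) : list loc := [Free; Real 2 r].

(** * Checks on the places and the table *)

Lemma prime_check (p : Z) :
  1 < p -> forallb (fun a => Z.gcd a p =? 1) (range 1 (p - 1)) = true -> prime p.
Proof.
  intros Hp H. rewrite forallb_forall in H. split; auto.
  intros a Ha. apply Zgcd_1_rel_prime, Z.eqb_eq, H, in_range. lia.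
Qed.

Lemma places_prime : Forall prime (map fst places).
Proof.
  unfold places; cbn [map fst].
  repeat (apply Forall_cons; [apply prime_check; (lia || reflexivity)|]). apply Forall_nil.
Qed.

Lemma prime_29 : prime 29.
Proof. apply prime_check; (lia || reflexivity). Qed.

Lemma places_NoDup : NoDup (map fst places).
Proof. repeat constructor; simpl; lia. Qed.

Lemma table_covers : covers places (map repeated twenty_fives ++ table) = true.
Proof. vm_compute. reflexivity. Qed.

(* The first two entries stand for the moduli [1] and [25], which the other entries avoid. *)
Lemma table_types : NoDup (map (types places) ([] :: repeated 0 :: table)).
Proof.
  match goal with |- NoDup ?l =>
    assert (E : nodup (list_eq_dec Nat.eq_dec) l = l) by (vm_compute; reflexivity); rewrite <- E
  end.
  apply NoDup_nodup.
Qed.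

(** * The moduli of the whole family *)

Definition main : list (list (Z * (nat * Z))) := flat_map (expand places) table.

Definition tails : list (list (Z * (nat * Z))) := flat_map tail_cover places.

Lemma NoDup_main : NoDup (1 :: 25 :: map modulus_of main).
Proof. exact (NoDup_expand _ _ places_prime places_NoDup table_types). Qed.

Lemma in_tails (s : list (Z * (nat * Z))) :
  In s tails ->
  exists p k i c, In p (map fst places) /\ s = [(29, (1%nat, i)); (p, (S k, c))].
Proof.
  intros H. apply in_flat_map in H as (pb & Hpb & H).
  apply in_map_iff in H as (k & <- & _).
  exists (fst pb), k. do 2 eexists. split; [|reflexivity]. now apply in_map.
Qed.

Lemma tail_modulus (p i c : Z) (k : nat) :
  modulus_of [(29, (1%nat, i)); (p, (S k, c))] = 29 * p ^ Z.of_nat (S k).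
Proof. unfold modulus_of, exponent; cbn [fold_right fst snd]. now rewrite Z.mul_1_r. Qed.

Lemma NoDup_tails : NoDup (map modulus_of tails).
Proof.
  unfold tails.
  rewrite flat_map_concat_map, concat_map, map_map, <- flat_map_concat_map.
  apply NoDup_flat_map with (key := fst); [| |exact places_NoDup].
  - intros pb Hpb. unfold tail_cover. rewrite map_map.
    apply NoDup_map_weaken with (f := fun k => k); [|rewrite map_id; apply seq_NoDup].
    intros x y _ _. rewrite !tail_modulus. intros E.
    apply Z.mul_reg_l in E; [|lia].
    assert (Hp : prime (fst pb)).
    { pose proof places_prime as H. rewrite Forall_forall in H. now apply H, in_map. }
    apply Z.pow_inj_r in E; try lia. pose proof (prime_ge_2 _ Hp). lia.
  - intros pb pb' m Hpb Hpb' Hm Hm'. unfold tail_cover in Hm, Hm'.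
    rewrite map_map in Hm, Hm'.
    apply in_map_iff in Hm as (k & <- & _). apply in_map_iff in Hm' as (k' & E & _).
    rewrite !tail_modulus in E. apply Z.mul_reg_l in E; [|lia].
    pose proof places_prime as H. rewrite Forall_forall in H.
    (* After cancelling 29, one prime divides a power of the other. *)
    apply prime_power_prime with (n := Z.of_nat (S k')); try lia; try (now apply H, in_map).
    rewrite E, Nat2Z.inj_succ, Z.pow_succ_r by lia. apply Z.divide_factor_l.
Qed.

Lemma not_29_divides_main (s : list (Z * (nat * Z))) : In s main -> ~ (29 | modulus_of s).
Proof.
  intros H Hd. apply in_expand in H. pose proof places_prime as Hp. rewrite <- H in Hp.
  assert (Hr : rel_prime 29 (modulus_of s)).
  { apply rel_prime_modulus_of; auto using prime_29.
    rewrite H. simpl. lia. }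
  destruct Hr as [_ _ Hr]. specialize (Hr 29 (Z.divide_refl _) Hd).
  apply Z.divide_1_r in Hr. lia.
Qed.

(** The prime 29 separates the lists: it divides every tail modulus, but neither 1, nor 25, nor any
    modulus from [main]. *)
Lemma NoDup_moduli : NoDup (1 :: 25 :: map modulus_of (main ++ tails)).
Proof.
  rewrite map_app. apply (NoDup_app (l1 := 1 :: 25 :: map modulus_of main)).
  - exact NoDup_main.
  - exact NoDup_tails.
  - intros m Hm Hm'. apply in_map_iff in Hm' as (s & <- & Hs).
    apply in_tails in Hs as (p & k & i & c & Hp & ->).
    rewrite tail_modulus in Hm.
    assert (Hd : (29 | 29 * p ^ Z.of_nat (S k))) by apply Z.divide_factor_l.
    destruct Hm as [Hm|[Hm|Hm]].
    + rewrite <- Hm in Hd. apply Z.divide_1_r in Hd. lia.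
    + rewrite <- Hm in Hd. destruct Hd. lia.
    + apply in_map_iff in Hm as (s & Hs & Hin).
      apply (not_29_divides_main s Hin). now rewrite Hs.
Qed.

Lemma Odd_modulus_of (s : list (Z * (nat * Z))) :
  Forall Z.Odd (map fst s) -> Z.Odd (modulus_of s).
Proof.
  induction s as [|x s IH]; simpl; intros H; [now exists 0|].
  inversion H; subst. apply Z.odd_spec. rewrite Z.odd_mul, andb_true_iff. split.
  - rewrite Z.odd_spec. unfold exponent. destruct (fst (snd x)); [now exists 0|].
    apply Z.odd_spec. rewrite Z.odd_pow by lia. now apply Z.odd_spec.
  - apply Z.odd_spec. auto.
Qed.

Lemma items_primes (s : list (Z * (nat * Z))) :
  In s (main ++ tails) -> NoDup (map fst s) /\ incl (map fst s) (29 :: map fst places).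
Proof.
  intros H. apply in_app_or in H as [H|H].
  - apply in_expand in H. rewrite H. split; [exact places_NoDup|].
    intros p. simpl. auto.
  - apply in_tails in H as (p & k & i & c & Hp & ->). simpl map. split.
    + constructor; [|repeat constructor; auto].
      intros [->|[]]. simpl in Hp. lia.
    + intros q [<-|[<-|[]]]; [left|right]; auto.
Qed.

(** [chinese_remainder] item by item. Keeping the moduli in order carries [NoDup_moduli] over to
    [S]. *)
Lemma items_congruences (l : list (list (Z * (nat * Z)))) :
  incl l (main ++ tails) ->
  exists S, map modulus S = map modulus_of l /\
            forall n s, In s l -> Forall (locally n) s -> Exists (satisfies n) S.
Proof.
  induction l as [|s l IH]; intros Hl.
  - exists []. split; auto. intros n s [].
  - destruct IH as (S & HS & Hsat); [intros x Hx; apply Hl; now right|].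
    destruct (items_primes s) as [Hd Hi]; [apply Hl; now left|].
    destruct (chinese_remainder s) as (c & Hm & Hc); auto.
    { apply (incl_Forall Hi). constructor; [exact prime_29 | exact places_prime]. }
    exists (c :: S). split; [simpl; congruence|].
    intros n s' [<-|Hs'] Hn; [left|right]; eauto.
Qed.

Theorem theorem2p8 :
  exists S : list congruence,
    covering_system S /\
    pairwise_distinct S /\
    Forall (fun c => Z.Odd (modulus c) /\ 1 < modulus c) S /\
    length (filter (fun c => modulus c =? 25) S) = 8%nat /\
    NoDup (map modulus (filter (fun c => negb (modulus c =? 25)) S)).
Proof.
  destruct (items_congruences (main ++ tails) (incl_refl _)) as (S & HS & Hsat).
  pose proof NoDup_moduli as Hd. rewrite <- HS in Hd.
  assert (Hodd : Forall (fun c => Z.Odd (modulus c) /\ 1 < modulus c) S).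
  { apply Forall_forall. intros c Hc.
    assert (Hin : In (modulus c) (map modulus_of (main ++ tails)))
      by (rewrite <- HS; now apply in_map).
    (* The list in [Hd] is headed by 1, so 1 is not among the moduli of [S]. *)
    assert (Hne : modulus c <> 1).
    { intros E. inversion Hd; subst. apply H1. right. rewrite <- E. now apply in_map. }
    apply in_map_iff in Hin as (s & Es & Hs). rewrite <- Es in Hne |- *.
    apply items_primes in Hs as [_ Hs]. split.
    - apply Odd_modulus_of, (incl_Forall Hs).
      repeat constructor; apply Z.odd_spec; reflexivity.
    - enough (0 < modulus_of s) by lia. apply modulus_of_pos, (incl_Forall Hs).
      constructor; [exact prime_29 | exact places_prime]. }
  (* Likewise 25 is not a modulus of [S], so the congruences modulo 25 are exactly those of [T]. *)
  inversion Hd as [|? ? _ Hd']; subst. inversion Hd' as [|? ? H25 HdS]; subst.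
  set (T := map (fun r => Congruence r 25) twenty_fives).
  assert (H25S : forall c, In c S -> (modulus c =? 25) = false).
  { intros c Hc. apply Z.eqb_neq. intros E. apply H25. rewrite <- E. now apply in_map. }
  assert (HS25 : filter (fun c => modulus c =? 25) S = []).
  { clear - H25S. induction S as [|c S IH]; simpl; auto.
    rewrite H25S by now left. apply IH. intros; apply H25S. now right. }
  assert (HSn25 : filter (fun c => negb (modulus c =? 25)) S = S).
  { clear - H25S. induction S as [|c S IH]; simpl; auto.
    rewrite H25S by now left. simpl. f_equal. apply IH. intros; apply H25S. now right. }
  assert (HT : Forall (fun c => Z.Odd (modulus c) /\ 1 < modulus c) (T ++ S)).
  { apply Forall_app. split; auto. apply Forall_forall. intros c Hc.
    apply in_map_iff in Hc as (r & <- & _). simpl. split; [now exists 12 | lia]. }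
  exists (T ++ S). repeat split; auto.
  - eapply Forall_impl; [|exact HT]. simpl. lia.
  - intros n. apply Exists_app.
    destruct (tails_or_coords places n places_prime)
      as [(pb & Hpb & Ht)|(zs & Hzs & Hhit)].
    + right. apply tail_covered in Ht as (s & Hs & Hn). apply (Hsat n s); auto.
      apply in_or_app. right. apply in_flat_map. eauto.
    + destruct (covers_correct _ _ _ table_covers Hzs) as (e & He & Hh).
      apply Hhit in Hh as (s & Hs & Hn).
      apply in_app_or in He as [He|He].
      * left. apply in_map_iff in He as (r & <- & Hr).
        apply Exists_exists. exists (Congruence r 25).
        split; [now apply (in_map (fun r => Congruence r 25))|].
        (* The only option of [repeated r] at the prime 5 is [(2, r)], and its local condition is
           [25 | n - r]. *)
        apply in_map_iff in Hs as (v & <- & Hv).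
        apply in_product in Hv. cbn in Hv.
        inversion Hv as [|o1 ? v1 ? _ Hv1]; subst. inversion Hv1 as [|o2 ? v2 ? Ho2 _]; subst.
        destruct Ho2 as [<-|[]].
        inversion Hn; subst. inversion H2; subst. exact H3.
      * right. apply (Hsat n s); auto. apply in_or_app. left. apply in_flat_map. eauto.
  - unfold pairwise_distinct. rewrite map_app. apply NoDup_app.
    + vm_compute. repeat constructor; simpl; intuition congruence.
    + apply NoDup_map_weaken with (f := modulus); auto. intros c d _ _ E. congruence.
    + intros x Hx Hx'. apply in_map_iff in Hx as (c & <- & Hc).
      apply in_map_iff in Hx' as (d & E & Hd0).
      apply in_map_iff in Hc as (r & <- & _). apply H25S in Hd0.
      apply Z.eqb_neq in Hd0. simpl in E. congruence.
  - rewrite filter_app, HS25, app_nil_r. reflexivity.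
  - rewrite filter_app, HSn25. exact HdS.
Qed.
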